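(* Let $(P_n)_{n\ge0}$ be a monic orthogonal polynomial sequence (MOPS) and let $(\beta_n)_{n\ge0}$ and $(\gamma_n)_{n\ge1}$ be the corresponding sequences of recurrence coefficients. Let $(Q_n)_{n\ge0}$ be a simple set of polynomials such that $$Q_n(x)+r_nQ_{n-1}(x)=P_n(x)+s_nP_{n-1}(x)+t_nP_{n-2}(x),\qquad n\ge0,$$ where $(r_n)_{n\ge0}$, $(s_n)_{n\ge0}$, $(t_n)_{n\ge0}$ are sequences of complex numbers with $r_0=s_0=t_0=t_1=0$ and such that $$t_2\ne r_2(s_1-r_1),\qquad r_nt_n\ne0\quad(n\ge3).$$ Set $$\widetilde\beta_n:=\beta_n+s_n-s_{n+1}-r_n+r_{n+1},\quad n\ge0,$$ $$\widetilde\gamma_n:=\gamma_n+t_n-t_{n+1}+s_n(s_{n+1}-s_n-\beta_n+\beta_{n-1})-r_n(r_{n+1}-r_n-\widetilde\beta_n+\widetilde\beta_{n-1}),\quad n\ge1,$$ $$a_n:=\gamma_n+t_n-t_{n+1}+s_n(s_{n+1}-s_n-\beta_n+\beta_{n-1}),\quad n\ge1,$$ $$b_n:=s_n\gamma_{n-1}+t_n(s_{n+1}-s_n-\beta_n+\beta_{n-2}),\quad d_n:=r_n\widetilde\gamma_{n-1},\quad n\ge2,\qquad c_3:=t_3\gamma_1.$$ Then the following two statements are equivalent: (i) $(Q_n)_n$ is a MOPS with $(\widetilde\beta_n)_n$ and $(\widetilde\gamma_n)_n$ the corresponding sequences of recurrence coefficients. (ii) It holds $\widetilde\gamma_1\widetilde\gamma_2\neq0$,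 together with the initial conditions $$b_2-d_2=a_2(s_1-r_1),\qquad b_3-d_3=a_3(s_2-r_2),\qquad c_3-b_3(s_1-r_1)=a_3[t_2-s_2(s_1-r_1)],$$ $$t_4\gamma_2=a_4t_3,$$ and there exist complex constants $A$, $B$, $C$ (independent of $n$) such that, for all $n\ge3$, $$A_n:=\frac{s_na_{n+1}}{t_{n+1}}-\beta_{n-1}-\beta_n+s_{n+1}=A,$$ $$B_n:=\frac{a_na_{n+1}}{t_{n+1}}+(s_n-\beta_{n-1})\left(\frac{s_na_{n+1}}{t_{n+1}}-\beta_n-s_n+s_{n+1}\right)+t_n-a_n-\gamma_{n-1}=B,$$ $$C_n:=\widetilde\beta_n-r_{n+1}-\frac{\widetilde\gamma_n}{r_n}=C.$$
   Context: A simple set of polynomials is a sequence $(Q_n)_{n\ge0}$ with $\deg Q_n=n$ for every $n$. A MOPS is a sequence $(R_n)_{n\ge0}$ of monic complex polynomials, $\deg R_n=n$, for which there is a linear functional $\mathbf w$ on the space of complex polynomials (called regular) with $\langle\mathbf w,R_nR_m\rangle=0$ for $n\neq m$ and $\langle\mathbf w,R_n^2\rangle\neq0$ for all $n$. Its recurrence coefficients are the complex sequences $(\beta_n)_{n\ge0}$, $(\gamma_n)_{n\ge1}$, with $\gamma_n\ne0$ for all $n\ge1$, such that $R_{n+1}(x)=(x-\beta_n)R_n(x)-\gamma_nR_{n-1}(x)$, $n\ge0$, with $R_0=1$, $R_{-1}=0$. Polynomials with negative index are zero. *)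

(* Defs.v *)
From HB Require Import structures.
From mathcomp Require Import all_boot all_order all_algebra.
From mathcomp Require Import reals.
From mathcomp Require Export complex.

Set Implicit Arguments.
Unset Strict Implicit.
Unset Printing Implicit Defensive.

Import Order.TTheory GRing.Theory Num.Theory.
Local Open Scope ring_scope.
Local Open Scope complex_scope.

(* [lag k P n] is P_{n-k}, polynomials with negative index being zero;
   the plain [P (n - k)%N] would be P_0 when n < k. *)
Definition lag (R : realType) (k : nat) (P : nat -> {poly R[i]}) (n : nat) :
  {poly R[i]} := if (k <= n)%N then P (n - k)%N else 0.

(* [size p] is the degree plus one. *)
Definition simple_set (R : realType) (Q : nat -> {poly R[i]}) : Prop :=
  forall n, size (Q n) = n.+1.

Definition orthogonal_wrt (R : realType) (w : {scalar {poly R[i]}})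
    (P : nat -> {poly R[i]}) : Prop :=
  (forall n m, n <> m -> w (P n * P m) = 0) /\
  (forall n, w (P n ^+ 2) != 0).

Definition mops (R : realType) (P : nat -> {poly R[i]}) : Prop :=
  [/\ simple_set P,
      forall n, P n \is monic
    & exists w : {scalar {poly R[i]}}, orthogonal_wrt w P].

(* [gamma] is indexed from 1: its value at 0 only ever multiplies P_{-1} = 0. *)
Definition recurrence_coefs (R : realType) (P : nat -> {poly R[i]})
    (beta gamma : nat -> R[i]) : Prop :=
  [/\ P 0%N = 1,
      forall n, (1 <= n)%N -> gamma n != 0
    & forall n, P n.+1 = ('X - (beta n)%:P) * P n - gamma n *: lag 1 P n].

(* Main.v *)
(** Put X_n := Q_n + r_n Q_{n-1} = P_n + s_n P_{n-1} + t_n P_{n-2}, and let D_n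
    be the defect of the wanted recurrence for Q at n.  Expanding x X_n - X_{n+1}
    with both expressions of X_n and eliminating Q_n, P_n by the relation at n-1
    gives D_{k+2} + r_{k+2} D_{k+1} = y P_k + z P_{k-1} - x Q_k, where, with all
    indices of a, b, c, d equal to k+2 and c_n := t_n gamma_{n-2},
    x = d - a r_{k+1}, y = b - a s_{k+1}, z = c - a t_{k+1}.  So the recurrence
    says that x Q_k = y P_k + z P_{k-1} for all k.  For k = 0, 1 these are the
    first three initial conditions; for k >= 2 they force x = y = z = 0, because
    t_2 <> r_2 (s_1 - r_1) prevents Q_k - P_k from being a multiple of P_{k-1}.
    Granted the fourth initial condition (z = 0 at k = 2), the difference
    formulas for A_n, B_n, C_n show that x = y = z = 0 for all k >= 2 means that
    these three sequences are constant.  Favard's theorem turns the recurrence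
    into orthogonality. *)
Require Import Defs.
From HB Require Import structures.
From mathcomp Require Import all_boot all_order all_algebra.
From mathcomp Require Import reals ring.

Set Implicit Arguments.
Unset Strict Implicit.
Unset Printing Implicit Defensive.

Import Order.TTheory GRing.Theory Num.Theory.
Local Open Scope ring_scope.
Local Open Scope complex_scope.

(** * Identities between the coefficients *)

Section Coefficients.

Variables (F : fieldType) (beta gamma r s t : nat -> F).

Definition coef_a n :=
  gamma n + t n - t n.+1 + s n * (s n.+1 - s n - beta n + beta n.-1).
Definition coef_b n :=
  s n * gamma n.-1 + t n * (s n.+1 - s n - beta n + beta n.-2).
Definition betat n := beta n + s n - s n.+1 - r n + r n.+1.
Definition gammat n :=
  coef_a n - r n * (r n.+1 - r n - betat n + betat n.-1).
Definition coef_A n :=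
  s n * coef_a n.+1 / t n.+1 - beta n.-1 - beta n + s n.+1.
Definition coef_B n :=
  coef_a n * coef_a n.+1 / t n.+1
  + (s n - beta n.-1) * (s n * coef_a n.+1 / t n.+1 - beta n - s n + s n.+1)
  + t n - coef_a n - gamma n.-1.
Definition coef_C n := betat n - r n.+1 - gammat n / r n.

Lemma const_from3P (f : nat -> F) :
  (exists c, forall n, (3 <= n)%N -> f n = c) <->
  (forall n, f n.+4 = f n.+3).
Proof.
split=> [[c fc] n|fS]; first by rewrite !fc.
by exists (f 3) => -[|[|[|n]]] // _; elim: n => // n; rewrite fS.
Qed.

(** Inserting the definition of [gammat n.+1] into [coef_C n.+1] cancels every [betat]: the
    difference is [gammat n / r n - coef_a n.+1 / r n.+1]. *)
Lemma coef_CS n : r n != 0 -> r n.+1 != 0 ->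
  (coef_C n.+1 == coef_C n) = (r n.+1 * gammat n == coef_a n.+1 * r n).
Proof.
move=> rn0 rn10.
have: coef_C n.+1 - coef_C n
        = (r n.+1 * gammat n - coef_a n.+1 * r n) / (r n * r n.+1).
  by rewrite /coef_C {1}/gammat /=; field; rewrite rn10 rn0.
move=> E; rewrite -subr_eq0 -[RHS]subr_eq0 E mulf_eq0 invr_eq0 mulf_eq0.
by rewrite !(negPf rn0) !(negPf rn10) !orbF.
Qed.

(** The hypothesis amounts to [coef_a n.+3 / t n.+3 = gamma n.+1 / t n.+2], which turns the quotient
    in [coef_A n.+2] into the first term of [coef_b n.+2 / t n.+2]. *)
Lemma coef_AS n : t n.+3 * gamma n.+1 = coef_a n.+3 * t n.+2 ->
  t n.+2 != 0 -> t n.+3 != 0 ->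
  coef_A n.+2 - coef_A n.+1
    = (coef_b n.+2 - coef_a n.+2 * s n.+1) / t n.+2.
Proof.
move=> E t2 t3; have Ea: coef_a n.+3 = t n.+3 * gamma n.+1 / t n.+2.
  by rewrite E mulfK.
rewrite /coef_A Ea /coef_b /=; field; by rewrite t2.
Qed.

(** Equality of the two values of [coef_A] turns the last factor of [coef_B n.+2] into
    [s n.+1 * coef_a n.+2 / t n.+2 - beta n], so that both products involve the same quotient. *)
Lemma coef_BS n : t n.+2 != 0 -> t n.+3 != 0 ->
  coef_A n.+2 = coef_A n.+1 ->
  coef_B n.+2 - coef_B n.+1
    = coef_a n.+2 / t n.+2 * (t n.+2 * (coef_a n.+3 / t n.+3) - gamma n.+1)
      - (t n.+1 * (coef_a n.+2 / t n.+2) - gamma n).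
Proof.
move=> t2 t3 EA.
have {EA}: s n.+2 * coef_a n.+3 / t n.+3 - beta n.+2
   = s n.+1 * coef_a n.+2 / t n.+2 - beta n + s n.+2 - s n.+3.
  move: EA; rewrite /coef_A /= => EA.
  apply/eqP; rewrite -subr_eq0; move/eqP: EA; rewrite -subr_eq0 => /eqP <-.
  by apply/eqP; ring.
rewrite /coef_B /= => ->.
(* [coef_a n.+2] and [coef_a n.+3] stay folded: the identity holds for arbitrary values of them. *)
have ->: coef_a n.+1 = gamma n.+1 + t n.+1 - t n.+2
   + s n.+1 * (s n.+2 - s n.+1 - beta n.+1 + beta n) by [].
by field; rewrite t2.
Qed.

Lemma coef_ABP : (forall n, t n.+3 != 0) -> (forall n, gamma n.+1 != 0) ->
  t 4 * gamma 2 = coef_a 4 * t 3 ->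
  ((forall n, coef_A n.+4 = coef_A n.+3) /\
   (forall n, coef_B n.+4 = coef_B n.+3))
  <-> ((forall n, t n.+4 * gamma n.+2 = coef_a n.+4 * t n.+3) /\
       (forall n, coef_b n.+4 = coef_a n.+4 * s n.+3)).
Proof.
move=> t0 g0 E4.
(* B_{n+1} - B_n = u_n g_{n+1} - g_n with u_n := a_{n+1} / t_{n+1}, and
   g_n = 0 with gamma_{n-1} <> 0 forces u_n <> 0: vanishing of g propagates. *)
pose g n := t n * (coef_a n.+1 / t n.+1) - gamma n.-1.
have gE n : (t n.+4 * gamma n.+2 == coef_a n.+4 * t n.+3) = (g n.+3 == 0).
  have -> : g n.+3 = (coef_a n.+4 * t n.+3 - t n.+4 * gamma n.+2) / t n.+4.
    by rewrite /g /=; field.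
  by rewrite mulf_eq0 invr_eq0 (negPf (t0 _)) orbF subr_eq0 eq_sym.
split=> [[hA hB]|[hg hb]].
- have {}g0 n : g n.+3 = 0.
    elim: n => [|n IH]; first by apply/eqP; rewrite -gE E4.
    have := coef_BS (t0 n.+1) (t0 n.+2) (hA n).
    rewrite hB subrr -/(g n.+4) -/(g n.+3) IH subr0 => /esym/eqP.
    rewrite mulf_eq0 mulf_eq0 invr_eq0 (negPf (t0 _)) orbF => /orP[] /eqP // a0.
    move/eqP: IH; rewrite -gE a0 mul0r mulf_eq0.
    by rewrite (negPf (t0 _)) (negPf (g0 _)).
  have hg n : t n.+4 * gamma n.+2 = coef_a n.+4 * t n.+3.
    by apply/eqP; rewrite gE g0.
  split=> // n; have := coef_AS (hg n.+1) (t0 n.+1) (t0 n.+2).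
  rewrite hA subrr => /esym/eqP; rewrite mulf_eq0 invr_eq0 (negPf (t0 _)) orbF.
  by rewrite subr_eq0 => /eqP.
- have hA n : coef_A n.+4 = coef_A n.+3.
    apply/eqP; rewrite -subr_eq0 (coef_AS (hg n.+1)) ?t0 //.
    by rewrite hb subrr mul0r.
  split=> // n; apply/eqP; rewrite -subr_eq0 coef_BS ?t0 ?hA //.
  have {}hg m : g m.+3 = 0 by apply/eqP; rewrite -gE hg.
  by rewrite -/(g n.+4) -/(g n.+3) !hg mulr0 subr0.
Qed.

End Coefficients.
(** * Favard's theorem *)

Definition moment_functional (F : comNzRingType) (mu : nat -> F)
    (p : {poly F}) : F :=
  \sum_(i < size p) p`_i * mu i.

Lemma moment_functional_widen (F : comNzRingType) (mu : nat -> F) n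
    (p : {poly F}) : (size p <= n)%N ->
  moment_functional mu p = \sum_(i < n) p`_i * mu i.
Proof.
move=> le_p_n; rewrite /moment_functional.
rewrite -!(big_mkord xpredT (fun i => p`_i * mu i)).
rewrite [RHS](big_cat_nat (n := size p)) //=.
rewrite [X in _ + X]big1_seq ?addr0 // => i.
by rewrite mem_index_iota => /andP[_ /andP[le_p_i _]]; rewrite nth_default ?mul0r.
Qed.

Lemma moment_functional_is_linear (F : comNzRingType) (mu : nat -> F) :
  scalar (moment_functional mu).
Proof.
move=> c p q; pose n := maxn (size (c *: p + q)) (maxn (size p) (size q)).
rewrite !(@moment_functional_widen _ _ n) ?leq_max ?leqnn ?orbT //.
rewrite mulr_sumr -big_split /=; apply: eq_bigr => i _.
by rewrite coefD coefZ mulrDl mulrA.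
Qed.

HB.instance Definition _ (F : comNzRingType) (mu : nat -> F) :=
  GRing.isLinear.Build F {poly F} F *%R (moment_functional mu)
    (moment_functional_is_linear mu).

(* A list of moments, because each one depends on all the previous ones. *)
Fixpoint dual_moments (F : pzRingType) (Q : nat -> seq F) n : seq F :=
  if n isn't m.+1 then [:: 1] else
  let mu := dual_moments Q m in
  rcons mu (- \sum_(i < n) (Q n)`_i * mu`_i).

Lemma size_dual_moments (F : pzRingType) (Q : nat -> seq F) n :
  size (dual_moments Q n) = n.+1.
Proof. by elim: n => //= n IH; rewrite size_rcons IH. Qed.

Lemma nth_dual_moments (F : pzRingType) (Q : nat -> seq F) n i : (i <= n)%N ->
  (dual_moments Q n)`_i = (dual_moments Q i)`_i.
Proof.
elim: n => [|n IH]; first by rewrite leqn0 => /eqP ->.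
rewrite leq_eqVlt => /predU1P[-> // | lt_i_n].
by rewrite nth_rcons size_dual_moments lt_i_n IH.
Qed.

(** As [Q n] is monic, its image is the n-th moment plus a combination of earlier moments, so the
    moments can be chosen one after the other. *)
Lemma dual_functional (F : comNzRingType) (Q : nat -> {poly F}) :
  (forall n, size (Q n) = n.+1) -> (forall n, Q n \is monic) ->
  exists w : {scalar {poly F}}, w 1 = 1 /\ forall n, w (Q n.+1) = 0.
Proof.
move=> sQ mQ; pose mu n := (dual_moments (fun k => Q k : seq F) n)`_n.
exists (moment_functional mu); split=> [|n].
  rewrite /= (@moment_functional_widen _ _ 1) ?size_poly1 //.
  by rewrite big_ord1 coef1 mulr1.
rewrite /= /moment_functional sQ big_ord_recr /=.
have /monicP := mQ n.+1; rewrite lead_coefE sQ /= => ->.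
rewrite mul1r {2}/mu /= nth_rcons size_dual_moments ltnn eqxx.
apply/eqP; rewrite subr_eq0; apply/eqP; apply: eq_bigr => i _.
by rewrite nth_dual_moments // -ltnS.
Qed.

Lemma lag00 (R : realType) (P : nat -> {poly R[i]}) n : lag 0 P n = P n.
Proof. by rewrite /lag subn0. Qed.

Lemma lagS0 (R : realType) k (P : nat -> {poly R[i]}) : lag k.+1 P 0 = 0.
Proof. by []. Qed.

Lemma lagSS (R : realType) k (P : nat -> {poly R[i]}) n :
  lag k.+1 P n.+1 = lag k P n.
Proof. by rewrite /lag ltnS subSS. Qed.

Definition lagE := (lagSS, lagS0, lag00).

Lemma size_recurrence (R : realType) (P : nat -> {poly R[i]}) beta gamma n :
  recurrence_coefs P beta gamma -> P n \is monic /\ size (P n) = n.+1.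
Proof.
case=> P0 _ PS; elim/ltn_ind: n => -[|n] IH.
  by rewrite P0 monic1 size_poly1.
have [mPn sPn] := IH n (ltnSn n).
have sM : size (('X - (beta n)%:P) * P n) = n.+2.
  by rewrite size_monicM ?monicXsubC ?monic_neq0 // size_XsubC sPn.
have sL : (size (- (gamma n *: lag 1 P n)) < n.+2)%N.
  rewrite size_polyN (leq_ltn_trans (size_scale_leq _ _)) //.
  case: n IH {mPn sPn sM} => [|n] IH; first by rewrite lagE size_poly0.
  by rewrite !lagE (IH n _).2.
rewrite PS; split; last by rewrite size_polyDl ?sM.
by rewrite monicE lead_coefDl ?sM // -monicE monicMl ?monicXsubC.
Qed.

(** The functional is the one killing [P n] for all n > 0; the recurrence carries this over to
    ['X^k * P n] for k < n, and gives the squared norms as products of the [gamma n]. *)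
Lemma favard (R : realType) (P : nat -> {poly R[i]}) beta gamma :
  recurrence_coefs P beta gamma -> mops P.
Proof.
move=> recP; have mP n := (size_recurrence n recP).1.
have sP n := (size_recurrence n recP).2; have [P0 gamma0 PS] := recP.
split=> //; have [w [w1 wP]] := dual_functional sP mP; exists w.
have XP n : 'X * P n.+1 = P n.+2 + (beta n.+1 *: P n.+1 + gamma n.+1 *: P n).
  by rewrite (PS n.+1) -!mul_polyC !lagE; ring.
have wXP k n : (k < n)%N -> w ('X^k * P n) = 0.
  elim: k n => [|k IH] [|n] // ltkn; first by rewrite mul1r wP.
  rewrite exprSr -mulrA XP !mulrDr !linearD /= -!scalerAr !linearZ /=.
  have lt_k_n : (k < n)%N := ltkn.
  by rewrite !IH ?mulr0 ?addr0 ?leqW.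
have wpP (p : {poly R[i]}) n : (size p <= n)%N -> w (p * P n) = 0.
  move=> le_p_n; rewrite -[p]coefK poly_def mulr_suml linear_sum big1 // => i _.
  by rewrite -scalerAl linearZ /= wXP ?mulr0 // (leq_trans _ le_p_n).
split=> [n m|].
  by move=> /eqP; rewrite neq_ltn => /orP[] lt; last rewrite mulrC;
    rewrite wpP ?sP.
elim=> [|n IH]; first by rewrite P0 expr1n w1 oner_eq0.
have -> : w (P n.+1 ^+ 2) = gamma n.+1 * w (P n ^+ 2).
  (* One factor is expanded by the recurrence at n, then ['X * P n.+1] by the one at n+1. All terms
     but the first pair some [P m] with a polynomial of lower degree. *)
  have -> : P n.+1 ^+ 2 = gamma n.+1 *: P n ^+ 2 + (P n * P n.+2
      + (beta n.+1 - beta n) *: (P n * P n.+1)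
      - gamma n *: (lag 1 P n * P n.+1)).
    rewrite -!mul_polyC polyCB.
    have -> : P n.+2 = 'X * P n.+1 - beta n.+1 *: P n.+1 - gamma n.+1 *: P n.
      by rewrite XP; ring.
    by rewrite -!mul_polyC expr2 {1}(PS n) -mul_polyC; ring.
  have lag0 : w (lag 1 P n * P n.+1) = 0.
    by apply: wpP; case: (n) => [|m]; rewrite !lagE ?size_poly0 ?sP.
  rewrite linearD linearB linearD /= !linearZ /= lag0.
  have -> : w (P n * P n.+2) = 0 by apply: wpP; rewrite sP.
  have -> : w (P n * P n.+1) = 0 by apply: wpP; rewrite sP.
  by rewrite oppr0 scaler0 mulr0 !addr0.
by rewrite mulf_neq0 ?gamma0.
Qed.

Lemma size_lag (R : realType) (P : nat -> {poly R[i]}) k n :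
  simple_set P -> (size (lag k.+1 P n) <= n)%N.
Proof.
move=> sP; case: n => [|n]; first by rewrite lagE size_poly0.
by rewrite lagE /lag; case: ifP => _; rewrite ?size_poly0 // sP ltnS leq_subr.
Qed.

(** * The recurrence for the modified sequence *)

Section ModifiedSequence.

Variables (R : realType) (P Q : nat -> {poly R[i]}).
Variables (beta gamma r s t : nat -> R[i]).
Hypotheses (recP : recurrence_coefs P beta gamma) (sQ : simple_set Q).
Hypotheses (r0 : r 0 = 0) (s0 : s 0 = 0) (t1 : t 1 = 0).
Hypothesis PQ : forall n,
  Q n + r n *: lag 1 Q n = P n + s n *: lag 1 P n + t n *: lag 2 P n.

Local Notation a := (coef_a beta gamma s t).
Local Notation b := (coef_b beta gamma s t).
Local Notation bt := (betat beta r s).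
Local Notation gt := (gammat beta gamma r s t).

Definition recurrence_defect n :=
  'X * Q n - Q n.+1 - (bt n)%:P * Q n - (gt n)%:P * lag 1 Q n.

Let sP : simple_set P.
Proof. by move=> n; case: (size_recurrence n recP). Qed.

(** Scalars become constant polynomials, so that [ring] can treat the identities below. *)
Let P_S n : P n.+1 = ('X - (beta n)%:P) * P n - (gamma n)%:P * lag 1 P n.
Proof. by case: recP => _ _ ->; rewrite mul_polyC. Qed.

Let QE n : Q n = P n + (s n)%:P * lag 1 P n + (t n)%:P * lag 2 P n
                 - (r n)%:P * lag 1 Q n.
Proof. by rewrite !mul_polyC -PQ addrK. Qed.

Let P0 : P 0 = 1. Proof. by case: recP. Qed.
Let Q0 : Q 0 = 1. Proof. by rewrite QE !lagE P0; ring. Qed.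

(** With the zero values at small indices, [bt] and [gt] are such that the recurrence holds at 0 and
    1 without further conditions. *)
Lemma recurrence_defect0 : recurrence_defect 0 = 0.
Proof.
rewrite /recurrence_defect (QE 1) !lagE (P_S 0) !lagE P0 Q0 t1 /betat r0 s0.
by ring.
Qed.

Lemma recurrence_defect1 : recurrence_defect 1 = 0.
Proof.
rewrite /recurrence_defect (QE 2) !lagE (QE 1) !lagE (P_S 1) !lagE.
rewrite (P_S 0) !lagE P0 Q0 t1.
rewrite /gammat /coef_a /betat /= r0 s0 t1.
by ring.
Qed.

Lemma recurrence_defectSS k :
  recurrence_defect k.+2 + (r k.+2)%:P * recurrence_defect k.+1 =
  (b k.+2 - a k.+2 * s k.+1)%:P * P k
  + (t k.+2 * gamma k - a k.+2 * t k.+1)%:P * lag 1 P k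
  - (r k.+2 * gt k.+1 - a k.+2 * r k.+1)%:P * Q k.
Proof.
(* Expanding from the top index down leaves only ['X], [Q k], [P k] and [lag 1 P k]; [gt k.+1] can
   stay folded, its terms being the same on both sides. *)
rewrite /recurrence_defect !lagE (QE k.+3) !lagE (QE k.+2) !lagE.
rewrite (QE k.+1) !lagE.
rewrite (P_S k.+2) !lagE (P_S k.+1) !lagE (P_S k).
rewrite [gt k.+2]/gammat /coef_b /coef_a /betat /=.
by ring.
Qed.

(** The defects obey a first-order linear recursion starting from zero, so they all vanish exactly
    when its inhomogeneous terms do. *)
Lemma recurrence_iff :
  (forall n, Q n.+1 = ('X - (bt n)%:P) * Q n - gt n *: lag 1 Q n) <->
  (forall k, (r k.+2 * gt k.+1 - a k.+2 * r k.+1) *: Q k =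
     (b k.+2 - a k.+2 * s k.+1) *: P k
     + (t k.+2 * gamma k - a k.+2 * t k.+1) *: lag 1 P k).
Proof.
have DE n : Q n.+1 = ('X - (bt n)%:P) * Q n - gt n *: lag 1 Q n
    <-> recurrence_defect n = 0.
  rewrite -mul_polyC /recurrence_defect; split=> [->|]; first by ring.
  move=> E; apply/eqP; rewrite -subr_eq0 -oppr_eq0; apply/eqP; rewrite -{}[RHS]E.
  by ring.
split=> [recQ k | E n].
  have D m : recurrence_defect m = 0 by apply/DE.
  apply/eqP; rewrite -subr_eq0 -oppr_eq0 opprB -!mul_polyC.
  by rewrite -recurrence_defectSS !D mulr0 addr0.
apply/DE; case: n => [|n]; first exact: recurrence_defect0.
elim: n => [|n IH]; first exact: recurrence_defect1.
have := recurrence_defectSS n; rewrite IH mulr0 addr0 => ->.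
by rewrite !mul_polyC -E subrr.
Qed.

(** * Linear relations between Q_k, P_k and P_{k-1} *)

Let coefP n : (P n)`_n = 1.
Proof.
have [/monicP + _] := size_recurrence n recP.
by rewrite lead_coefE sP.
Qed.

Let coef_lagP k n : (lag k.+1 P n)`_n = 0.
Proof. by rewrite nth_default // size_lag. Qed.

(** A simple set need not be monic; here the relation with the monic [P] forces it. *)
Let coefQ n : (Q n)`_n = 1.
Proof.
rewrite QE coefB !coefD !coefCM !coef_lagP coefP.
by rewrite [(lag 1 Q n)`_n]nth_default ?size_lag // !mulr0 subr0 !addr0.
Qed.

Let lead_comb n x y z :
  x *: Q n = y *: P n + z *: lag 1 P n -> x = y.
Proof.
move/(congr1 (fun p : {poly _} => p`_n)).
by rewrite coefD !coefZ coefQ coefP coef_lagP mulr0 addr0 !mulr1.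
Qed.

(** Since [lag 1 P 0] is zero, z stays free and only one condition results. *)
Lemma comb0P x y z : x *: Q 0 = y *: P 0 + z *: lag 1 P 0 <-> x = y.
Proof. by split=> [/lead_comb // | ->]; rewrite Q0 P0 lagE scaler0 addr0. Qed.

Lemma comb1P x y z : x *: Q 1 = y *: P 1 + z *: lag 1 P 1 <->
  x = y /\ x * (s 1 - r 1) = z.
Proof.
have Q1E : Q 1 = P 1 + (s 1 - r 1)%:P.
  by rewrite QE !lagE P0 Q0 t1; ring.
split=> [E | [<- <-]].
  have xy := lead_comb E; split=> //; move: E; rewrite -xy Q1E.
  rewrite scalerDr lagE lagE P0 => /addrI.
  by rewrite -!mul_polyC -polyCM mulr1 => /polyC_inj.
by rewrite Q1E scalerDr !lagE P0 -!mul_polyC mulr1 -polyCM.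
Qed.

Hypothesis t2 : t 2 != r 2 * (s 1 - r 1).
Hypothesis rt : forall n, (3 <= n)%N -> r n * t n != 0.

(* Descent: if Q_{k+1} - P_{k+1} is a multiple of P_k, the relation at k+1 makes
   Q_k - P_k a multiple of P_{k-1}; at k = 2 this contradicts the hypothesis. *)
Lemma not_comb k l : Q k.+2 - P k.+2 != l *: P k.+1.
Proof.
elim: k l => [|k IH] l; apply/eqP => E.
  have Q1E : Q 1 = P 1 + (s 1 - r 1)%:P by rewrite QE !lagE P0 Q0 t1; ring.
  (* The coefficient of ['X] makes the first bracket vanish, and the constant left over is nonzero
     by [t2]. *)
  have {}E : (s 2 - r 2 - l)%:P * P 1 + (t 2 - r 2 * (s 1 - r 1))%:P = 0.
    move/eqP: E; rewrite -subr_eq0 => /eqP <-.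
    by rewrite QE !lagE Q1E P0 -mul_polyC; ring.
  have /eqP := congr1 (fun p : {poly _} => p`_1) E.
  rewrite coefD coefCM coefP mulr1 coefC addr0 coef0 => /eqP l0.
  move: E; rewrite l0 mul0r add0r => /eqP; rewrite polyC_eq0 subr_eq0.
  by rewrite (negPf t2).
have /norP[rk tk] : ~~ ((r k.+3 == 0) || (t k.+3 == 0)).
  by rewrite -mulf_eq0 rt.
have {}E : r k.+3 *: Q k.+2 = (s k.+3 - l) *: P k.+2 + t k.+3 *: lag 1 P k.+2.
  apply/eqP; rewrite -subr_eq0; move/eqP: E; rewrite -subr_eq0 -oppr_eq0.
  by rewrite {1}QE !lagE -!mul_polyC => /eqP <-; apply/eqP; ring.
(* Leading coefficients in [E] give [r k.+3 = s k.+3 - l]; division by [r k.+3] then produces this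
   multiple. *)
move/eqP: (IH (t k.+3 / r k.+3)); apply.
apply: (scalerI rk); rewrite scalerBr E -(lead_comb E) addrC addKr !lagE.
by rewrite scalerA mulrC divfK.
Qed.

Lemma combSSP k x y z : x *: Q k.+2 = y *: P k.+2 + z *: lag 1 P k.+2 <->
  [/\ x = 0, y = 0 & z = 0].
Proof.
split=> [E | [-> -> ->]]; last by rewrite !scale0r addr0.
have xy := lead_comb E; rewrite -{y}xy in E *.
have {}E : x *: (Q k.+2 - P k.+2) = z *: P k.+1.
  by rewrite scalerBr E !lagE addrC addKr.
have x0 : x = 0.
  apply/eqP/negPn/negP => x_neq0; move/eqP: (not_comb k (z / x)); apply.
  by rewrite mulrC -scalerA -E scalerA mulVf ?scale1r.
split=> //; move: E; rewrite x0 scale0r => /esym/eqP.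
by rewrite scaler_eq0 -[P _ == 0]size_poly_eq0 sP orbF => /eqP.
Qed.

End ModifiedSequence.

(** * The initial conditions and the equivalence *)

Lemma initial1P (F : comPzRingType) (a b d s r : F) :
  b - d = a * (s - r) <-> d - a * r = b - a * s.
Proof.
have -> : b - d = (b - a * s) - (d - a * r) + a * (s - r) by ring.
split=> [E | ->]; last by rewrite subrr add0r.
by apply/esym/subr0_eq/(addIr (a * (s - r))); rewrite E add0r.
Qed.

(** With w = s_1 - r_1, the left side is the second condition of [comb1P] after x is replaced by
    y. *)
Lemma initial2P (F : comPzRingType) (a b c s t w : F) :
  (b - a * s) * w = c - a * t <-> c - b * w = a * (t - s * w).
Proof.
have -> : c - b * w = (c - a * t) - (b - a * s) * w + a * (t - s * w) by ring.
split=> [-> | E]; first by rewrite subrr add0r.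
by apply/esym/subr0_eq/(addIr (a * (t - s * w))); rewrite E add0r.
Qed.

(* The sequences [gamma], [gammat], [a] are meaningful from index 1 on and
   [b], [d] from index 2 on; they are only used there, so the truncated
   predecessors below are genuine ones. *)
Theorem theorem3p2 (R : realType) (P Q : nat -> {poly R[i]})
    (beta gamma r s t : nat -> R[i])
    (hP : mops P) (hrec : recurrence_coefs P beta gamma)
    (hQ : simple_set Q)
    (hr0 : r 0%N = 0) (hs0 : s 0%N = 0) (ht0 : t 0%N = 0) (ht1 : t 1%N = 0)
    (hPQ : forall n : nat,
       Q n + r n *: lag 1 Q n = P n + s n *: lag 1 P n + t n *: lag 2 P n)
    (ht2 : t 2%N != r 2%N * (s 1%N - r 1%N))
    (hrt : forall n : nat, (3 <= n)%N -> r n * t n != 0) :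
  let betat := fun n : nat => beta n + s n - s n.+1 - r n + r n.+1 in
  let gammat := fun n : nat =>
    gamma n + t n - t n.+1 + s n * (s n.+1 - s n - beta n + beta n.-1)
    - r n * (r n.+1 - r n - betat n + betat n.-1) in
  let a := fun n : nat =>
    gamma n + t n - t n.+1 + s n * (s n.+1 - s n - beta n + beta n.-1) in
  let b := fun n : nat =>
    s n * gamma n.-1 + t n * (s n.+1 - s n - beta n + beta n.-2) in
  let d := fun n : nat => r n * gammat n.-1 in
  let c3 := t 3%N * gamma 1%N in
  let An := fun n : nat =>
    s n * a n.+1 / t n.+1 - beta n.-1 - beta n + s n.+1 in
  let Bn := fun n : nat =>
    a n * a n.+1 / t n.+1
    + (s n - beta n.-1) * (s n * a n.+1 / t n.+1 - beta n - s n + s n.+1)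
    + t n - a n - gamma n.-1 in
  let Cn := fun n : nat => betat n - r n.+1 - gammat n / r n in
  (mops Q /\ recurrence_coefs Q betat gammat)
  <->
  (gammat 1%N * gammat 2%N != 0 /\
   b 2%N - d 2%N = a 2%N * (s 1%N - r 1%N) /\
   b 3%N - d 3%N = a 3%N * (s 2%N - r 2%N) /\
   c3 - b 3%N * (s 1%N - r 1%N)
     = a 3%N * (t 2%N - s 2%N * (s 1%N - r 1%N)) /\
   t 4%N * gamma 2%N = a 4%N * t 3%N /\
   exists A B C : R[i], forall n : nat, (3 <= n)%N ->
     An n = A /\ Bn n = B /\ Cn n = C).
Proof.
move=> bt gt a b d c3 An Bn Cn; rewrite /d /c3 {d c3}.
rewrite -[bt]/(betat beta r s) -[gt]/(gammat beta gamma r s t).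
rewrite -[a]/(coef_a beta gamma s t) -[b]/(coef_b beta gamma s t).
rewrite -[An]/(coef_A beta gamma s t) -[Bn]/(coef_B beta gamma s t).
rewrite -[Cn]/(coef_C beta gamma r s t) {bt gt a b An Bn Cn} /=.
have [_ gamma_neq0 _] := hrec.
have [r_neq0 t_neq0] : (forall n, r n.+3 != 0) /\ (forall n, t n.+3 != 0).
  by split=> n; have := hrt n.+3 isT; rewrite mulf_eq0 => /norP[].
have recQE := recurrence_iff hrec hr0 hs0 ht1 hPQ.
have E0 := comb0P hrec hQ hPQ.
have E1 := comb1P hrec hQ ht1 hPQ.
have ESS := combSSP hrec hQ ht1 hPQ ht2 hrt.
have ABE := coef_ABP (beta := beta) (s := s) t_neq0
  (fun n => gamma_neq0 n.+1 isT).
have CS n := coef_CS beta gamma s t (r_neq0 n) (r_neq0 n.+1).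
split=> [[_ [_ gt_neq0 /recQE E]] | ].
  have /E0 e0 := E 0; have /E1 [e1 e1'] := E 1.
  have e k := (ESS _ _ _ _).1 (E k.+2).
  have eC k : coef_C beta gamma r s t k.+4 = coef_C beta gamma r s t k.+3.
    by apply/eqP; rewrite CS -subr_eq0; case: (e k) => ->.
  have et k : t k.+4 * gamma k.+2 = coef_a beta gamma s t k.+4 * t k.+3.
    by apply/eqP; rewrite -subr_eq0; case: (e k) => _ _ ->.
  have eb k : coef_b beta gamma s t k.+4 = coef_a beta gamma s t k.+4 * s k.+3.
    by apply/eqP; rewrite -subr_eq0; case: (e k) => _ ->.
  (* [et 0] is the fourth initial condition. *)
  have [/const_from3P[A hA] /const_from3P[B hB]] := (ABE (et 0)).2 (conj et eb).
  have /const_from3P[C hC] := eC.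
  split; first by rewrite mulf_neq0 ?gt_neq0.
  split; first exact/initial1P.
  split; first exact/initial1P.
  split; first by apply/initial2P => //; rewrite -e1.
  by split=> //; exists A, B, C => n n3; rewrite hA ?hB ?hC.
case=> gt12 [ic2 [ic3 [ic3' [ic4 [A [B [C hABC]]]]]]].
have hA n : coef_A beta gamma s t n.+4 = coef_A beta gamma s t n.+3.
  by have [[-> _] [-> _]] := (hABC n.+3 isT, hABC n.+4 isT).
have hB n : coef_B beta gamma s t n.+4 = coef_B beta gamma s t n.+3.
  by have [[_ [-> _]] [_ [-> _]]] := (hABC n.+3 isT, hABC n.+4 isT).
have hC n : coef_C beta gamma r s t n.+4 = coef_C beta gamma r s t n.+3.
  by have [[_ [_ ->]] [_ [_ ->]]] := (hABC n.+3 isT, hABC n.+4 isT).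
have [et eb] := (ABE ic4).1 (conj hA hB).
have er n : r n.+4 * gammat beta gamma r s t n.+3
    = coef_a beta gamma s t n.+4 * r n.+3 by apply/eqP; rewrite -CS hC.
(* From index 3 on, a zero of [gammat] would make the next [coef_a] zero by [er], and then a product
   of a [t] and a [gamma] zero by [et]. *)
have gt_neq0 n : (1 <= n)%N -> gammat beta gamma r s t n != 0.
  move: gt12; rewrite mulf_eq0 => /norP[gt1 gt2].
  case: n => [|[|[|n]]] // _; apply/eqP => gt0.
  have /eqP := er n; rewrite gt0 mulr0 eq_sym mulf_eq0 (negPf (r_neq0 _)) orbF.
  move=> /eqP a0; have /eqP := et n; rewrite a0 mul0r mulf_eq0.
  by rewrite (negPf (t_neq0 _)) (negPf (gamma_neq0 _ _)).
suff recQ : recurrence_coefs Q (betat beta r s) (gammat beta gamma r s t).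
  by split=> //; apply: favard recQ.
split=> //; last apply/recQE => -[|[|k]].
- have := hPQ 0; rewrite !lagE hs0 hr0 ht0 !scaler0 !addr0 => ->.
  by case: hrec.
- by apply/E0/initial1P.
- apply/E1; have e1 := (initial1P _ _ _ _ _).1 ic3.
  by split=> //; rewrite e1; apply/initial2P.
- by apply/ESS; rewrite er eb et !subrr.
Qed.
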